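(* Let $\mathcal{D}=\prod_{r=1}^d\mathcal{D}_r$ be a product distribution on $\{0,1\}^d$, where $\mu_r$ is the probability that $\mathcal{D}_r$ assigns to $0$, and let $\varepsilon\le 1/10$. Any monotonicity tester with respect to $\mathcal{D}$ with proximity parameter $\varepsilon$ for functions $f:\{0,1\}^d\to\mathbb{N}$ must make $\Omega\big(\sum_{r=1}^d\min(\mu_r,1-\mu_r)\big)$ queries.
   Context: $f$ is monotone if $f(x)\le f(y)$ whenever $x\le y$ coordinatewise. A monotonicity tester w.r.t. $\mathcal{D}$ with proximity parameter $\varepsilon$ (possibly adaptive, two-sided error) accepts monotone $f$ with probability $>2/3$ and rejects with probability $>2/3$ every $f$ with $\min_{g\text{ monotone}}\Pr_{x\sim\mathcal{D}}[f(x)\ne g(x)]>\varepsilon$. *)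

(* Defs.v *)
From HB Require Import structures.
From mathcomp Require Import all_boot all_order all_algebra.
From mathcomp Require Import all_classical all_reals all_analysis.
Set Implicit Arguments. Unset Strict Implicit. Unset Printing Implicit Defensive.
Import Order.TTheory GRing.Theory Num.Theory.
Local Open Scope ring_scope.
Local Open Scope classical_set_scope.

Definition cube (d : nat) := {ffun 'I_d -> bool}.

Definition cube_le (d : nat) (x y : cube d) : bool := [forall i, x i ==> y i].

Definition monotone (d : nat) (f : cube d -> nat) : Prop :=
  forall x y : cube d, cube_le x y -> (f x <= f y)%N.

Definition prodD (R : realType) (d : nat) (mu : 'I_d -> R) (x : cube d) : R :=
  \prod_(r < d) (if x r then 1 - mu r else mu r).

Definition distD (R : realType) (d : nat) (mu : 'I_d -> R)
  (f g : cube d -> nat) : R :=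
  \sum_(x : cube d | f x != g x) prodD mu x.

(* f is eps-far from monotone: min over monotone g of dist > eps,
   i.e. every monotone g has distance > eps (the min is attained). *)
Definition far (R : realType) (d : nat) (mu : 'I_d -> R) (eps : R)
  (f : cube d -> nat) : Prop :=
  forall g : cube d -> nat, monotone g -> distD mu f g > eps.

(* Deterministic adaptive query algorithm: a decision tree that queries
   points of the cube and branches on the (natural-number) answer. *)
Inductive qtree (d : nat) : Type :=
| Leaf of bool
| Query of cube d & (nat -> qtree d).

Fixpoint run (d : nat) (t : qtree d) (f : cube d -> nat) : bool :=
  match t with
  | Leaf b => b
  | Query x k => run (k (f x)) f
  end.

Inductive depth_le (d : nat) : qtree d -> nat -> Prop :=
| depth_leaf b n : depth_le (Leaf d b) n
| depth_query x k n : (forall v, depth_le (k v) n) -> depth_le (Query x k) n.+1.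

(* A randomized (possibly adaptive, two-sided error) monotonicity tester
   w.r.t. the product distribution given by mu, with proximity parameter eps,
   making at most q queries: a random variable T on a probability space
   (Omega, P) whose values are deterministic query trees of depth <= q. *)
Definition mono_tester (R : realType) (d : nat) (mu : 'I_d -> R) (eps : R)
  (d0 : measure_display) (Omega : measurableType d0) (P : probability Omega R)
  (T : Omega -> qtree d) (q : nat) : Prop :=
  [/\ (forall w, depth_le (T w) q),
      (forall f : cube d -> nat, measurable [set w | run (T w) f]),
      (forall f : cube d -> nat, monotone f ->
         (P [set w | run (T w) f] > (2 / 3 : R)%:E)%E) &
      (forall f : cube d -> nat, far mu eps f ->
         (P [set w | ~~ run (T w) f] > (2 / 3 : R)%:E)%E)].

(* Main.v *)
(* Cut the coordinates into n = Omega(sum min(mu_r, 1 - mu_r)) blocks in which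
   the event "some coordinate takes its rare value" has probability between 1/2
   and 3/4, and let Z_a be the disjunction (or conjunction) of block a. The
   function h = sum_a 2^a Z_a is monotone, whereas flipping Z_a gives a function
   f_a at distance at least 1/4 from monotone. Two points are compared
   differently by h and f_a only when a is the top bit in which their images
   under Z differ, and a set of q points has at most q such top bits.

   This rules out testers that only use the order of the answers. For a general
   tester, compose h and f_a with an increasing sequence s_0 < s_1 < ... and take
   the iterated limit of the acceptance probability as each s_i in turn tends
   to infinity along a free ultrafilter. The acceptance probability is a finite
   sum, over the sets X of queried points, of functions of the answers on X, and
   the iterated limit of each term depends only on the order of the values
   on X. This plays the role of Ramsey's theorem. The terms need not be
   measurable events, so the probability is first extended to a finitely
   additive one on all subsets that agrees with it on the countably many
   acceptance events. *)
Require Import Defs.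
From HB Require Import structures.
From mathcomp Require Import all_boot all_order all_algebra.
From mathcomp Require Import all_classical all_reals all_analysis.
From mathcomp Require Import ring lra.
Set Implicit Arguments. Unset Strict Implicit. Unset Printing Implicit Defensive.
Import Order.TTheory GRing.Theory Num.Theory.
Import numFieldNormedType.Exports.
Local Open Scope classical_set_scope.
Local Open Scope ring_scope.

(** * Limits along a free ultrafilter on the naturals *)

Lemma free_ultrafilter_exists :
  exists U : set_system nat, UltraFilter U /\ \oo `<=` U.
Proof. exact: ultraFilterLemma. Qed.

Definition free_ultrafilter : set_system nat := sval (cid free_ultrafilter_exists).

#[local] Instance free_ultrafilter_ultra : UltraFilter free_ultrafilter.
Proof. exact: (svalP (cid free_ultrafilter_exists)).1. Qed.

Lemma free_ultrafilter_oo (A : set nat) : \oo A -> free_ultrafilter A.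
Proof. exact: (svalP (cid free_ultrafilter_exists)).2. Qed.

Section UltraLimit.
Variable R : realType.
Implicit Types (u : nat -> R) (c : R).

Definition ulim u : R := lim (u @ free_ultrafilter).

(** Compactness of the unit interval gives a cluster point, and an ultrafilter converges to each of
    its cluster points. *)
Lemma cvg_ulim u : (forall n, 0 <= u n <= 1) ->
  u @ free_ultrafilter --> ulim u.
Proof.
move=> u01.
have [|p [_ clup]] := @segment_compact R 0 1 (u @ free_ultrafilter) _.
  by apply: (@filterE _ free_ultrafilter) => n /=; rewrite in_itv; exact: u01.
have up : u @ free_ultrafilter --> p.
  move=> N Np; have [//|UN] := in_ultra_setVsetC (u @^-1` N) free_ultrafilter_ultra.
  by have [x [/= nNx Nx]] := clup (~` N) N UN Np.
by have /(cvgP p) := up.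
Qed.

Lemma ulim_ge u c : (forall n, 0 <= u n <= 1) ->
  (\forall n \near \oo, c <= u n) -> c <= ulim u.
Proof.
move=> /cvg_ulim uu /free_ultrafilter_oo cu.
exact: cvgr_to_ge uu cu.
Qed.

Lemma ulim_le u c : (forall n, 0 <= u n <= 1) ->
  (\forall n \near \oo, u n <= c) -> ulim u <= c.
Proof.
move=> /cvg_ulim uu /free_ultrafilter_oo cu.
exact: cvgr_to_le uu cu.
Qed.

Lemma ulim01 u : (forall n, 0 <= u n <= 1) -> 0 <= ulim u <= 1.
Proof.
move=> u01; apply/andP; split.
  by apply: ulim_ge => //; apply: nearW => n; have /andP[] := u01 n.
by apply: ulim_le => //; apply: nearW => n; have /andP[] := u01 n.
Qed.

Lemma ulim_cst c : ulim (fun=> c) = c.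
Proof. exact: lim_cst. Qed.

Lemma ulim_eq_near u c : (forall n, 0 <= u n <= 1) ->
  (\forall n \near \oo, u n = c) -> ulim u = c.
Proof.
move=> u01 uc; apply: le_anti.
by rewrite ulim_ge ?ulim_le//; apply: filterS uc => n ->.
Qed.

Lemma ulim_sum (I : finType) (u : I -> nat -> R) :
  (forall i n, 0 <= u i n <= 1) ->
  ulim (fun n => \sum_i u i n) = \sum_i ulim (u i).
Proof.
move=> u01; apply: cvg_lim => //.
elim: (index_enum I) => [|i r IHr].
  by rewrite big_nil; under eq_fun do rewrite big_nil; apply: cvg_cst.
rewrite big_cons; under eq_fun do rewrite big_cons.
by apply: cvgD IHr; apply: cvg_ulim.
Qed.

End UltraLimit.

(** * Iterated limits of functions of several variables *)

Section IteratedUltraLimit.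
Variable R : realType.
Implicit Types (H : seq nat -> R) (c : R).

Fixpoint itlim (k : nat) H : R :=
  if k is k'.+1 then ulim (fun v => itlim k' (fun s => H (v :: s)))
  else H [::].

Lemma eq_itlim k H1 H2 : (forall s, size s = k -> H1 s = H2 s) ->
  itlim k H1 = itlim k H2.
Proof.
elim: k H1 H2 => [|k IHk] H1 H2 eqH /=; first exact: eqH.
congr ulim; apply/funext => v; apply: IHk => s sk.
by apply: eqH; rewrite /= sk.
Qed.

Lemma itlim01 k H : (forall s, 0 <= H s <= 1) -> 0 <= itlim k H <= 1.
Proof.
by elim: k H => [|k IHk] H H01 //=; apply: ulim01 => n; apply: IHk.
Qed.

(** The limit in the head variable is outermost: the later variables go to infinity while the head
    is fixed, so they eventually exceed it. Hence only increasing sequences matter. *)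
Lemma itlim_ge m k H c : (forall s, 0 <= H s <= 1) ->
  (forall s, size s = k -> path ltn m s -> c <= H s) -> c <= itlim k H.
Proof.
elim: k m H => [|k IHk] m H H01 cH /=; first exact: cH.
apply: ulim_ge => [n|]; first exact: itlim01.
near=> v; apply: (IHk v) => // s sk vs; apply: cH; rewrite /= ?sk// vs andbT.
by near: v; exact: nbhs_infty_gt.
Unshelve. all: by end_near. Qed.

Lemma itlim_le m k H c : (forall s, 0 <= H s <= 1) ->
  (forall s, size s = k -> path ltn m s -> H s <= c) -> itlim k H <= c.
Proof.
elim: k m H => [|k IHk] m H H01 cH /=; first exact: cH.
apply: ulim_le => [n|]; first exact: itlim01.
near=> v; apply: (IHk v) => // s sk vs; apply: cH; rewrite /= ?sk// vs andbT.
by near: v; exact: nbhs_infty_gt.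
Unshelve. all: by end_near. Qed.

Lemma itlim_sum k (I : finType) (H : I -> seq nat -> R) :
  (forall i s, 0 <= H i s <= 1) ->
  itlim k (fun s => \sum_i H i s) = \sum_i itlim k (H i).
Proof.
elim: k H => [|k IHk] H H01 //=.
under [X in ulim X]eq_fun => v do rewrite IHk//.
by apply: ulim_sum => i v; apply: itlim01.
Qed.

(* A function of some of the variables has the same iterated limit as the
   function of fewer variables that it factors through: limits in the unused
   variables are limits of constants. *)
Lemma itlim_mask k (b : bitseq) H : size b = k -> (forall s, 0 <= H s <= 1) ->
  itlim k (fun s => H (mask b s)) = itlim (count id b) H.
Proof.
elim: b k H => [|[] b IHb] [|k] H //= [sb] H01.
  by congr ulim; apply/funext => v; rewrite (IHb k (fun s => H (v :: s))).
by rewrite IHb// ulim_cst.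
Qed.

End IteratedUltraLimit.

(** * Finitely additive extension of a probability *)

Section FinitelyAdditiveExtension.
Variables (R : realType) (d0 : measure_display) (Omega : measurableType d0).
Variable P : probability Omega R.

(** Additivity is stated for the fibres of a finite-valued map, since events will be split by the
    set of queried points; no measurability is asked of the pieces. *)
Definition fin_additive (Q : set Omega -> R) : Prop :=
  forall (I : finType) (tau : Omega -> I) (E : set Omega),
    Q E = \sum_i Q (E `&` [set w | tau w = i]).

Lemma fine_probability01 (B : set Omega) : measurable B ->
  0 <= fine (P B) <= 1.
Proof.
move=> mB; rewrite fine_ge0//= -[leRHS]/(fine 1%:E).
by rewrite fine_le ?fin_num_measure// probability_le1.
Qed.

Lemma fine_probability_split (B A : set Omega) : measurable B -> measurable A ->
  fine (P B) = fine (P (B `&` A)) + fine (P (B `\` A)).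
Proof.
move=> mB mA; rewrite -fineD ?fin_num_measure//; [|exact: measurableI|exact: measurableD].
rewrite -measureU; [|exact: measurableI|exact: measurableD|].
  by rewrite setUIDK.
by rewrite setDE setIACA setICr setI0.
Qed.

(* The witness is a combination of point masses, one per atom of the algebra
   generated by [A 0, .., A (n - 1)]; it is built by splitting [B] along
   [A (n - 1)]. *)
Lemma point_mass_extension (A : nat -> set Omega) (n : nat) (B : set Omega) :
  (forall i, measurable (A i)) -> measurable B ->
  exists Q : set Omega -> R,
    [/\ forall E, 0 <= Q E, fin_additive Q,
        forall E, E `&` B = set0 -> Q E = 0,
        forall E, B `<=` E -> Q E = fine (P B) &
        forall i, (i < n)%N -> Q (A i) = fine (P (B `&` A i))].
Proof.
move=> mA; elim: n B => [|n IHn] B mB.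
  have [->|/set0P[w Bw]] := eqVneq B set0.
    exists (fun=> 0); split=> //; last by rewrite measure0.
    by move=> I tau E; rewrite big1.
  exists (fun E => fine (P B) * (w \in E)%:R); split=> //.
  - by move=> E; rewrite mulr_ge0// fine_ge0.
  - move=> I tau E; rewrite -mulr_sumr; congr (_ * _).
    rewrite (bigD1 (tau w))//= big1 ?addr0 => [|i iw].
      by rewrite in_setI [X in _ && X]mem_set ?andbT.
    rewrite in_setI [X in _ && X]memNset ?andbF//= => wi.
    by rewrite wi eqxx in iw.
  - move=> E EB; rewrite memNset ?mulr0// => Ew.
    by have : (E `&` B) w by []; rewrite EB.
  - by move=> E BE; rewrite mem_set ?mulr1//; apply: BE.
have mBA : measurable (B `&` A n) by exact: measurableI.
have mBD : measurable (B `\` A n) by exact: measurableD.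
have [Q1 [Q1ge0 Q1add Q10 Q1B Q1A]] := IHn _ mBA.
have [Q2 [Q2ge0 Q2add Q20 Q2B Q2A]] := IHn _ mBD.
exists (fun E => Q1 E + Q2 E); split.
- by move=> E; rewrite addr_ge0.
- by move=> I tau E; rewrite big_split/= -Q1add -Q2add.
- move=> E EB; by rewrite Q10 ?Q20 ?addr0// ?setDE setIA EB set0I.
- move=> E BE; rewrite Q1B ?Q2B -?fine_probability_split//.
  + by move=> w [/BE].
  + by move=> w [/BE].
- move=> i; rewrite ltnS leq_eqVlt => /orP[/eqP ->|lt_in].
    rewrite Q1B ?Q20 ?addr0//; first by rewrite setDE setICA setICr setI0.
  rewrite Q1A// Q2A// (@fine_probability_split (B `&` A i) (A n))//; last exact: measurableI.
  by rewrite !setDE (setIAC B (A n)) (setIAC B (~` A n)).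
Qed.

(** The ultralimit of the extensions for the first [n] events: additivity passes to the limit, and
    the value at each [A i] is constant once [n] exceeds [i]. *)
Lemma fin_additive_extension (A : nat -> set Omega) :
  (forall i, measurable (A i)) ->
  exists Q : set Omega -> R,
    [/\ forall E, 0 <= Q E <= 1, fin_additive Q, Q set0 = 0 &
        forall i, Q (A i) = fine (P (A i))].
Proof.
move=> mA.
have /choice[q qP] n := point_mass_extension n mA (@measurableT _ Omega).
have q01 E n : 0 <= q n E <= 1.
  have [q0 qadd _ qT _] := qP n; rewrite q0/=.
  have <- : q n setT = 1 by rewrite qT// probability_setT.
  rewrite (qadd _ (fun w => w \in E) setT) big_bool/=.
  rewrite setTI (_ : [set w | _] = E) ?lerDl//.
  by apply/seteqP; split => w; [exact: set_mem | exact: mem_set].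
exists (fun E => ulim (q ^~ E)); split.
- by move=> E; apply: ulim01.
- move=> I tau E; rewrite -ulim_sum//; congr ulim; apply/funext => n.
  by have [_ qadd _ _ _] := qP n; exact: qadd.
- rewrite (_ : q ^~ set0 = fun=> 0) ?ulim_cst//.
  by apply/funext => n; have [_ _ -> //] := qP n; rewrite set0I.
- move=> i; apply: ulim_eq_near => //; near=> n.
  have [_ _ _ _ ->] := qP n; first by rewrite setTI.
  by near: n; exact: nbhs_infty_gt.
Unshelve. all: by end_near. Qed.

End FinitelyAdditiveExtension.

(** * Iterated limits see only the order of the values *)

Section OrderInvariance.

Lemma nth_mask (T : Type) (x0 : T) (b : bitseq) (s : seq T) (j : nat) :
  size b = size s -> nth false b j ->
  nth x0 (mask b s) (count id (take j b)) = nth x0 s j.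
Proof.
elim: b s j => [|[] b IHb] [|v s] [|j] //= [sb] bj; exact: IHb.
Qed.

Lemma count_take_mem (l : seq nat) (K k : nat) : (k <= K)%N ->
  count id (take k (mkseq (mem l) K)) = size (undup [seq v <- l | (v < k)%N]).
Proof.
move=> kK; rewrite /mkseq -map_take take_iota (minn_idPl kK) count_map -size_filter.
apply: perm_size; apply: uniq_perm; rewrite ?filter_uniq ?iota_uniq ?undup_uniq//.
by move=> v; rewrite mem_undup !mem_filter mem_iota andbC.
Qed.

Lemma size_undup_map (T : eqType) (g g' : T -> nat) (s : seq T) :
  {in s &, forall x y, (g x == g y) = (g' x == g' y)} ->
  size (undup (map g s)) = size (undup (map g' s)).
Proof.
elim: s => [//|x s IHs] eqg /=.
have -> : (g x \in map g s) = (g' x \in map g' s).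
  apply/mapP/mapP => -[y ys /eqP].
    by rewrite eqg ?inE ?eqxx ?ys ?orbT// => /eqP; exists y.
  by rewrite -eqg ?inE ?eqxx ?ys ?orbT// => /eqP; exists y.
have {}IHs : size (undup (map g s)) = size (undup (map g' s)).
  by apply: IHs => y z ys zs; apply: eqg; rewrite inE ?ys ?zs orbT.
by case: ifP => _ //=; rewrite IHs.
Qed.

Variables (R : realType) (D : finType) (X : {set D}) (G : (D -> nat) -> R).
Hypothesis G01 : forall f, 0 <= G f <= 1.
Hypothesis G_local : forall f f' : D -> nat, {in X, f =1 f'} -> G f = G f'.

Definition rank_in (g : D -> nat) (x : D) : nat :=
  size (undup [seq g y | y <- enum X & (g y < g x)%N]).

(** By locality only the entries of [s] indexed by values of [g] on [X] matter. Masking out the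
    others moves the entry at index [g x] to the position given by the rank of [g x] among these
    values. *)
Lemma itlim_rank (K : nat) (g : D -> nat) : (forall x, (g x < K)%N) ->
  itlim K (fun s => G (fun x => nth 0%N s (g x))) =
  itlim (size (undup [seq g y | y <- enum X]))
    (fun s => G (fun x => nth 0%N s (rank_in g x))).
Proof.
move=> gK; set l := [seq g y | y <- enum X].
pose b := mkseq (mem l) K.
have sb : size b = K by rewrite size_mkseq.
have -> : size (undup l) = count id b.
  rewrite -[b]take_size sb count_take_mem//; congr (size (undup _)).
  apply/esym/all_filterP/allP => v /mapP[y _ ->]; exact: gK.
rewrite -(itlim_mask (H := fun s => G (fun x => nth 0%N s (rank_in g x))) sb)//.
apply: eq_itlim => s sK; apply: G_local => x xX.
have -> : rank_in g x = count id (take (g x) b).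
  by rewrite count_take_mem ?(ltnW (gK x))// filter_map.
by rewrite nth_mask ?sb// nth_mkseq//; apply: map_f; rewrite mem_enum.
Qed.

Lemma itlim_order_invariant (K : nat) (g g' : D -> nat) :
  (forall x, (g x < K)%N) -> (forall x, (g' x < K)%N) ->
  {in X &, forall x y, (g x < g y)%N = (g' x < g' y)%N} ->
  itlim K (fun s => G (fun x => nth 0%N s (g x))) =
  itlim K (fun s => G (fun x => nth 0%N s (g' x))).
Proof.
move=> gK g'K ltgg'.
have eqgg' : {in X &, forall x y, (g x == g y) = (g' x == g' y)}.
  move=> x y xX yX.
  rewrite !eqn_leq (leqNgt (g x)) (leqNgt (g y)) (leqNgt (g' x)) (leqNgt (g' y)).
  by rewrite !ltgg'.
rewrite (itlim_rank gK) (itlim_rank g'K) (@size_undup_map _ g g'); last first.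
  by move=> x y; rewrite !mem_enum; apply: eqgg'.
apply: eq_itlim => s _; apply: G_local => x xX; congr (nth _ _ _).
rewrite /rank_in.
have -> : [seq y <- enum X | (g y < g x)%N] = [seq y <- enum X | (g' y < g' x)%N].
  by apply: eq_in_filter => y yX; apply: ltgg'; rewrite // -mem_enum.
apply: size_undup_map => y z; rewrite mem_filter mem_enum => /andP[_ yX].
by rewrite mem_filter mem_enum => /andP[_ zX]; apply: eqgg'.
Qed.

End OrderInvariance.

(** * From a tester to acceptance weights per queried set *)

Section TesterProfile.
Variable d : nat.

Fixpoint queried (t : qtree d) (f : cube d -> nat) : {set cube d} :=
  if t is Query x k then (x |: queried (k (f x)) f)%SET else finset.set0.

Lemma queried_local (t : qtree d) (f f' : cube d -> nat) :
  {in queried t f, f =1 f'} ->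
  queried t f' = queried t f /\ run t f' = run t f.
Proof.
elim: t => [b|x k IHk] //= ff'.
rewrite -ff' ?setU11//.
by have [|-> ->] := IHk (f x); first by move=> y yt; apply: ff'; rewrite setU1r.
Qed.

Lemma card_queried (t : qtree d) (f : cube d -> nat) (n : nat) :
  depth_le t n -> (#|queried t f| <= n)%N.
Proof.
elim=> [b m|x k m _ IHk] /=; first by rewrite cards0.
by rewrite cardsU1 -[m.+1]add1n leq_add// leq_b1.
Qed.

(** [G X f] is the extended probability that the tester accepts [f] having queried exactly the set
    [X]. The answers on [X] determine such a run, which makes [G X] local. *)
Lemma tester_profile (R : realType) (mu : 'I_d -> R) (eps : R)
    (d0 : measure_display) (Omega : measurableType d0)
    (P : probability Omega R) (T : Omega -> qtree d) (q : nat) :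
  mono_tester mu eps P T q ->
  exists G : {set cube d} -> (cube d -> nat) -> R,
    [/\ forall X f, 0 <= G X f <= 1,
        forall (X : {set cube d}) f f', {in X, f =1 f'} -> G X f = G X f',
        forall (X : {set cube d}) f, (q < #|X|)%N -> G X f = 0,
        (forall f, \sum_X G X f <= 1) /\
        (forall f, Defs.monotone f -> 2 / 3 <= \sum_X G X f) &
        forall f, far mu eps f -> \sum_X G X f <= 1 / 3].
Proof.
move=> [Tq Tmeas Tacc Trej].
(* Functions on the finite cube are countable, so the acceptance events form a sequence; an index
   that codes no function gets the zero function. *)
pose e i (x : cube d) : nat := odflt [ffun=> 0%N] (unpickle i : option {ffun cube d -> nat}) x.
have [Q [Q01 Qadd Q0 QA]] :=
  fin_additive_extension P (fun i => Tmeas (e i)).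
have Qrun f : Q [set w | run (T w) f] = fine (P [set w | run (T w) f]).
  have <- : e (pickle [ffun x => f x]) = f.
    by apply/funext => x; rewrite /e pickleK/= ffunE.
  exact: QA.
pose G X f := Q ([set w | run (T w) f] `&` [set w | queried (T w) f = X]).
have GQ f : \sum_X G X f = fine (P [set w | run (T w) f]).
  by rewrite -Qrun [RHS](Qadd _ (fun w => queried (T w) f)).
exists G; split.
- by move=> X f; apply: Q01.
- have sub (X : {set cube d}) f f' : {in X, f =1 f'} ->
      [set w | run (T w) f] `&` [set w | queried (T w) f = X] `<=`
      [set w | run (T w) f'] `&` [set w | queried (T w) f' = X].
    move=> ff' w [/= rw qw]; have [|-> ->//] := @queried_local (T w) f f'.
    by rewrite qw.
  move=> X f f' ff'; congr Q; apply/seteqP; split; apply: sub => //.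
  by move=> x xX; rewrite ff'.
- move=> X f qX; rewrite /G -[RHS]Q0; congr Q.
  apply/seteqP; split => // w [_ /= qw].
  by have := card_queried f (Tq w); rewrite qw leqNgt qX.
- split=> f; first by rewrite GQ; have /andP[] := fine_probability01 P (Tmeas f).
  move=> /Tacc; rewrite GQ -[P _ in X in X -> _]fineK ?fin_num_measure//.
  by rewrite lte_fin => /ltW.
- move=> f /Trej.
  have -> : [set w | ~~ run (T w) f] = ~` [set w | run (T w) f].
    by apply/seteqP; split => w /= /negP.
  rewrite GQ probability_setC//.
  rewrite -[P _ in X in X -> _]fineK ?fin_num_measure// -EFinB lte_fin.
  by move=> ?; lra.
Qed.

End TesterProfile.

(** * Binary values and top differing bits *)

Section BinaryValues.
Variable n : nat.
Implicit Types (z : cube n) (a t c : 'I_n).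

Definition binval z : nat := (\sum_(c < n) z c * 2 ^ c)%N.

Definition flip a z : cube n := [ffun c => z c (+) (c == a)].

Definition topdiff t z z' : bool :=
  (z t != z' t) && [forall c : 'I_n, (t < c)%N ==> (z c == z' c)].

Lemma topdiffC t z z' : topdiff t z z' = topdiff t z' z.
Proof.
rewrite /topdiff eq_sym; congr (_ && _).
by apply: eq_forallb => c; rewrite eq_sym.
Qed.

Lemma topdiff_exists z z' : z != z' -> exists t, topdiff t z z'.
Proof.
move=> zz'; have [c0 c0P] : exists c, z c != z' c.
  apply/existsP; apply: contraR zz' => /existsPn eqzz'; apply/eqP/ffunP => c.
  by have /negPn/eqP := eqzz' c.
case: (@arg_maxnP _ c0 (fun c => z c != z' c) val c0P) => t tP tmax; exists t.
rewrite /topdiff tP/=; apply/forallP => c; apply/implyP => tc.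
by apply: contraLR tc => /tmax; rewrite -leqNgt.
Qed.

Lemma topdiff_flip a t z z' : topdiff t (flip a z) (flip a z') = topdiff t z z'.
Proof.
rewrite /topdiff !ffunE (inj_eq (can_inj (addbK _))); congr (_ && _).
by apply: eq_forallb => c; rewrite !ffunE (inj_eq (can_inj (addbK _))).
Qed.

Lemma sum_pow2_lt a : (\sum_(c < n | c < a) 2 ^ c < 2 ^ a)%N.
Proof.
rewrite -(big_ord_widen n (fun i => 2 ^ i)%N (ltnW (ltn_ord a))).
by have := predn_exp 2 a; rewrite mul1n => <-; rewrite prednK ?expn_gt0.
Qed.

Lemma topdiff_binval_lt t z z' : topdiff t z z' -> z' t -> (binval z < binval z')%N.
Proof.
move=> /andP[neq_t /forallP eq_above] z't.
have zt : z t = false by move: neq_t; rewrite z't; case: (z t).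
rewrite /binval (bigID (fun c => t < c)%N)/= [ltnRHS](bigID (fun c => t < c)%N)/=.
rewrite (eq_bigr (fun c => z' c * 2 ^ c)%N); last first.
  by move=> c tc; have /implyP/(_ tc)/eqP -> := eq_above c.
rewrite ltn_add2l (bigD1 t) ?ltnn// [ltnRHS](bigD1 t) ?ltnn//= zt z't mul0n mul1n.
rewrite add0n (leq_trans _ (leq_addr _ _))//.
apply: leq_ltn_trans (sum_pow2_lt t).
rewrite [leqRHS](eq_bigl (fun c => ~~ (t < c) && (c != t))%N); last first.
  by move=> c; rewrite -leqNgt ltn_neqAle andbC.
by apply: leq_sum => c _; case: (z c); rewrite ?mul1n ?mul0n.
Qed.

Lemma topdiff_binval t z z' : topdiff t z z' -> (binval z < binval z')%N = z' t.
Proof.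
move=> tzz'; have [z't|z't] := boolP (z' t); first exact: topdiff_binval_lt tzz' _.
apply/negbTE; rewrite -leqNgt ltnW//; apply: (@topdiff_binval_lt t).
  by rewrite topdiffC.
by move: tzz' => /andP[]; rewrite (negbTE z't); case: (z t).
Qed.

(** The top differing bit decides the order. Flipping bit [a] in both points keeps that position,
    and reverses the order only when the position is [a]. *)
Lemma binval_flip_order a z z' : ~~ topdiff a z z' ->
  (binval z < binval z')%N = (binval (flip a z) < binval (flip a z'))%N.
Proof.
have [->|/topdiff_exists[t tzz'] natop] := eqVneq z z'; first by rewrite !ltnn.
rewrite (topdiff_binval tzz') (@topdiff_binval t) ?topdiff_flip// ffunE.
have [ta|_] := eqVneq t a; last by rewrite addbF.
by rewrite -ta tzz' in natop.
Qed.

(* Sending a distinguished bit [a] to the least element of [X] having a partner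
   in [X] that lies below it with top difference [a] is injective. *)
Lemma card_topdiffs (D : finType) (Z : D -> cube n) (X : {set D}) :
  (#|[pred a | [exists x in X, exists y in X, topdiff a (Z x) (Z y)]]| <= #|X|)%N.
Proof.
set S := [pred a | _].
pose W a x := [&& x \in X, Z x a & [exists y in X, topdiff a (Z x) (Z y)]].
have minW a : exists ox : option D, a \in S -> exists2 x, ox = Some x &
    W a x /\ forall x', W a x' -> (binval (Z x) <= binval (Z x'))%N.
  have [aS|] := boolP (a \in S); last by exists None.
  have [x0 Wx0] : exists x, W a x.
    move: aS => /exists_inP[x xX /exists_inP[y yX axy]].
    have [Zxa|Zxa] := boolP (Z x a).
      by exists x; rewrite /W xX Zxa; apply/exists_inP; exists y.
    exists y; rewrite /W yX; have /andP[] := axy; rewrite (negbTE Zxa).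
    case: (Z y a) => // _ _; apply/exists_inP; exists x => //.
    by rewrite topdiffC.
  case: (@arg_minnP _ x0 (W a) (fun x => binval (Z x)) Wx0) => x Wx xmin.
  by exists (Some x) => _; exists x.
have [f fP] := choice minW.
have f_inj : {in S &, injective f}.
  have contra a a' : a \in S -> a' \in S -> f a = f a' -> (a < a')%N -> False.
    move=> /fP[x -> [/and3P[_ Zxa /exists_inP[y yX axy]] _]].
    move=> /fP[x2 -> [/and3P[_ Zxa' /exists_inP[y' y'X a'xy']] xmin]] [eqx] aa'.
    subst x2.
    have /andP[_ /forallP eqxy] := axy.
    have {}eqxy c : (a < c)%N -> Z x c = Z y c by have /implyP := eqxy c => /[apply]/eqP.
    (* Above [a], the partner [y] agrees with [x], so it also has bit [a'] set and top difference
       [a'] with [y']. Being below [x], it contradicts minimality. *)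
    have /xmin : W a' y.
      rewrite /W yX -eqxy// Zxa'/=; apply/exists_inP; exists y' => //.
      move: a'xy' => /andP[neq_a' /forallP eqxy']; rewrite /topdiff -eqxy// neq_a'/=.
      apply/forallP => c; apply/implyP => a'c; rewrite -eqxy ?(ltn_trans aa')//.
      by have /implyP := eqxy' c; exact.
    by rewrite leqNgt (topdiff_binval_lt _ Zxa)// topdiffC.
  move=> a a' aS a'S faa'; apply/val_inj; case: (ltngtP a a') => // aa'.
  - by case: (contra a a').
  - by case: (contra a' a).
have someI : injective (@Some D) by move=> x y [].
rewrite -(card_imset (mem X) someI) -(card_in_imset f_inj).
apply/subset_leq_card/fintype.subsetP => _ /imsetP[a /fP[x -> [/and3P[xX _ _] _]] ->].
exact: imset_f.
Qed.

End BinaryValues.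

(** * Double counting of queries *)

Section QueryBound.
Variables (R : realType) (d n q : nat) (Z : cube d -> cube n).
Variable G : {set cube d} -> (cube d -> nat) -> R.
Hypothesis G01 : forall X f, 0 <= G X f <= 1.
Hypothesis G_local : forall (X : {set cube d}) (f f' : cube d -> nat),
  {in X, f =1 f'} -> G X f = G X f'.
Hypothesis G_large : forall (X : {set cube d}) f, (q < #|X|)%N -> G X f = 0.
Hypothesis G_le1 : forall f, \sum_X G X f <= 1.
Hypothesis G_accept : forall s : seq nat, path ltn 0 s ->
  (forall z : cube n, (binval z < size s)%N) ->
  2 / 3 <= \sum_X G X (fun x => nth 0%N s (binval (Z x))).
Hypothesis G_reject : forall (s : seq nat) (a : 'I_n), path ltn 0 s ->
  (forall z : cube n, (binval z < size s)%N) ->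
  \sum_X G X (fun x => nth 0%N s (binval (flip a (Z x)))) <= 1 / 3.

(** Each of the [n] flips changes the limiting acceptance weight by at least 1/3. A set [X]
    contributes only for flips at its top differences, at most [q] of them, and the total weight is
    at most 1. *)
Lemma query_bound : (n <= 3 * q)%N.
Proof.
(* One more than the largest binary value: one limit variable per value. *)
pose K := (\sum_(c < n) 2 ^ c).+1%N.
have zK (z : cube n) : (binval z < K)%N.
  by rewrite ltnS; apply: leq_sum => c _; case: (z c); rewrite ?mul1n ?mul0n.
pose A X (g : cube d -> nat) := itlim K (fun s => G X (fun x => nth 0%N s (g x))).
have A01 X g : 0 <= A X g <= 1 by apply: itlim01.
have sum01 f : 0 <= \sum_X G X f <= 1.
  by rewrite G_le1 andbT sumr_ge0// => X _; have /andP[] := G01 X f.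
pose h x := binval (Z x); pose hf a x := binval (flip a (Z x)).
have Ah : 2 / 3 <= \sum_X A X h.
  rewrite -itlim_sum//; apply: (@itlim_ge _ 0) => // s sK s0.
  by apply: G_accept => // z; rewrite sK.
have Ah1 : \sum_X A X h <= 1.
  by rewrite -itlim_sum//; apply: (@itlim_le _ 0).
have Ahf a : \sum_X A X (hf a) <= 1 / 3.
  rewrite -itlim_sum//; apply: (@itlim_le _ 0) => // s sK s0.
  by apply: G_reject => // z; rewrite sK.
pose S (X : {set cube d}) :=
  [pred a | [exists x in X, exists y in X, topdiff a (Z x) (Z y)]].
have diffA X a : A X h - A X (hf a) <= A X h * (a \in S X)%:R.
  have [aS|aS] := boolP (a \in S X).
    by rewrite mulr1 lerBlDl lerDr; have /andP[] := A01 X (hf a).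
  rewrite mulr0 subr_le0 le_eqVlt; apply/orP; left; apply/eqP.
  apply: itlim_order_invariant => //; [exact: G_local|by move=> x; exact: zK..|].
  move=> x y xX yX; apply: binval_flip_order; apply: contra aS => axy.
  by apply/exists_inP; exists x => //; apply/exists_inP; exists y.
have AS X : A X h * #|S X|%:R <= A X h * q%:R.
  have [/andP[A0 _]] := A01 X h; have [Xq|qX] := leqP #|X| q.
    by rewrite ler_wpM2l// ler_nat (leq_trans (card_topdiffs _ _)).
  suff -> : A X h = 0 by rewrite !mul0r.
  apply/le_anti; rewrite A0 andbT.
  by apply: (@itlim_le _ 0) => // s _ _; rewrite G_large.
have : n%:R * (1 / 3) <= \sum_(a < n) (\sum_X A X h - \sum_X A X (hf a)) :> R.
  rewrite -[X in X%:R * _]card_ord mulr_natl -sumr_const; apply: ler_sum => a _.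
  by have := Ahf a; lra.
under eq_bigr do rewrite -sumrB.
rewrite exchange_big/= => /le_trans nle.
have {}nle : n%:R * (1 / 3) <= q%:R :> R.
  apply: (nle); apply: (@le_trans _ _ (\sum_X A X h * q%:R)); last first.
    by rewrite -mulr_suml -[leRHS]mul1r ler_wpM2r.
  apply: ler_sum => X _; apply: le_trans (AS X).
  apply: (le_trans (ler_sum _ (fun a _ => diffA X a))).
  rewrite -mulr_sumr -sum1_card [X in _ <= _ * X%:R]big_mkcond natr_sum.
  by rewrite le_eqVlt (eq_bigr (fun a => (a \in S X)%:R)) ?eqxx// => a _; case: (a \in S X).
by rewrite -(ler_nat R) natrM; lra.
Qed.

End QueryBound.

(** * Resampling in a product distribution *)

Section ProductDistribution.
Variables (R : realType) (d : nat) (mu : 'I_d -> R).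
Hypothesis mu01 : forall r, 0 <= mu r <= 1.
Implicit Types (x y : cube d) (B : pred 'I_d).

Lemma prodD_ge0 x : 0 <= prodD mu x.
Proof.
apply: prodr_ge0 => r _; have /andP[mu0 mu1] := mu01 r.
by case: ifP; rewrite ?subr_ge0.
Qed.

Lemma sum_prodD_box B (b : bool) :
  \sum_(x : cube d | [forall r, B r ==> (x r == b)]) prodD mu x =
  \prod_(r < d | B r) (if b then 1 - mu r else mu r).
Proof.
pose F r (c : bool) := if c then 1 - mu r else mu r.
transitivity (\prod_(r < d) \sum_(c | B r ==> (c == b)) F r c).
  rewrite (@bigA_distr_big_dep _ _ _ _ _ _ _ (fun r c => B r ==> (c == b)))/=.
  by apply: eq_bigl => x; apply/forallP/familyP => Bx r; have := Bx r.
rewrite [RHS]big_mkcond; apply: eq_bigr => r _; case: (B r) => /=.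
  by rewrite big_pred1_eq.
by rewrite big_bool /F/= subrK.
Qed.

Lemma sum_prodD : \sum_(x : cube d) prodD mu x = 1.
Proof.
have := sum_prodD_box pred0 true; rewrite big_pred0_eq => <-.
by apply: eq_bigl => x; apply/esym/forallP.
Qed.

Definition mix B x y : cube d := [ffun r => if B r then y r else x r].

Lemma prodD_mix B x y :
  prodD mu (mix B x y) * prodD mu (mix B y x) = prodD mu x * prodD mu y.
Proof.
rewrite /prodD -!big_split/=; apply: eq_bigr => r _.
by rewrite !ffunE; case: (B r) => //; rewrite mulrC.
Qed.

(** Exchanging the coordinates in [B] between two independent points is an involution on pairs that
    preserves their joint weight. *)
Lemma expectation_mix B (F : cube d -> R) :
  \sum_x prodD mu x * \sum_y prodD mu y * F (mix B x y) =
  \sum_x prodD mu x * F x.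
Proof.
pose sw (p : cube d * cube d) := (mix B p.1 p.2, mix B p.2 p.1).
have swK : involutive sw.
  by move=> [x y]; congr (_, _); apply/ffunP => r; rewrite !ffunE/=; case: (B r).
transitivity (\sum_(p : cube d * cube d) prodD mu p.1 * prodD mu p.2 * F p.1).
  rewrite (reindex_inj (inv_inj swK))/= -(pair_bigA _ (fun x y =>
    prodD mu (mix B x y) * prodD mu (mix B y x) * F (mix B x y)))/=.
  apply: eq_bigr => x _; rewrite mulr_sumr; apply: eq_bigr => y _.
  by rewrite prodD_mix mulrA.
rewrite -(pair_bigA _ (fun x y => prodD mu x * prodD mu y * F x))/=.
apply: eq_bigr => x _; rewrite -[RHS]mulr1 -sum_prodD mulr_sumr.
by apply: eq_bigr => y _; rewrite mulrAC.
Qed.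

(* Resampling the coordinates in [B] preserves the distribution, so it suffices
   to bound the weight of [bad] on each fibre, where either the point that is
   constantly [b] on [B] is bad, or all the others are. *)
Lemma bad_weight_ge B (b : bool) (bad : pred (cube d)) :
  let w := \prod_(r < d | B r) (if b then 1 - mu r else mu r) in
  (forall x y, [forall r, B r ==> (x r == b)] ->
     ~~ [forall r, B r ==> (y r == b)] ->
     (forall r, ~~ B r -> x r = y r) -> bad x || bad y) ->
  Num.min w (1 - w) <= \sum_(x : cube d | bad x) prodD mu x.
Proof.
move=> w badP; pose box x := [forall r, B r ==> (x r == b)].
have wE : w = \sum_(x | box x) prodD mu x by rewrite sum_prodD_box.
have w'E : 1 - w = \sum_(x | ~~ box x) prodD mu x.
  by have := sum_prodD; rewrite (bigID box)/= -wE => <-; rewrite addrAC subrr add0r.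
have -> : \sum_(x : cube d | bad x) prodD mu x = \sum_x prodD mu x * (bad x)%:R.
  by rewrite big_mkcond; apply: eq_bigr => x _; case: (bad x); rewrite (mulr1, mulr0).
rewrite -(expectation_mix B) -[leLHS]mul1r -[X in X * _ <= _]sum_prodD mulr_suml.
apply: ler_sum => x _; rewrite ler_wpM2l ?prodD_ge0//.
have box_mix y : box (mix B x y) = box y.
  by apply: eq_forallb => r; rewrite ffunE; case: (B r).
have weight (A : pred (cube d)) : (forall y, A y -> bad (mix B x y)) ->
    \sum_(y | A y) prodD mu y <= \sum_y prodD mu y * (bad (mix B x y))%:R.
  move=> Abad; rewrite big_mkcond; apply: ler_sum => y _.
  case: ifP => [/Abad ->|_]; first by rewrite mulr1.
  by rewrite mulr_ge0 ?prodD_ge0.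
have [bad_box|/forallPn[x0]] :=
  boolP [forall y, box y ==> bad (mix B x y)].
  apply: le_trans (weight box _); first by rewrite -wE ge_min lexx.
  move=> y.
  by have /forallP/(_ y)/implyP := bad_box.
rewrite negb_imply => /andP[box0 good0].
apply: le_trans (weight (predC box) _); first by rewrite -w'E ge_min lexx orbT.
move=> y ybox.
have := badP (mix B x x0) (mix B x y); rewrite (negbTE good0); apply.
- by rewrite -/(box _) box_mix.
- by rewrite -/(box _) box_mix.
- by move=> r /negbTE Br; rewrite !ffunE Br.
Qed.

End ProductDistribution.

(** * Greedy partition into blocks *)

Section Blocks.

(* In the last conjunct, [1 + t] times the current product of the [1 - p i] does
   not increase when [p i] is added to [t >= 0]; closing a block costs it a
   total weight of at most [3 / 2]. *)
Lemma greedy_blocks (R : realFieldType) (I : eqType) (p : I -> R) (s : seq I) :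
  uniq s -> (forall i, 0 <= p i <= 1 / 2) ->
  exists (c : I -> nat) (n : nat),
    [/\ forall i, i \in s -> (c i <= n)%N,
        forall a, (a < n)%N -> 1 / 4 <= \prod_(i <- s | c i == a) (1 - p i) <= 1 / 2,
        1 / 2 < \prod_(i <- s | c i == n) (1 - p i) &
        (1 + \sum_(i <- s) p i - 3 / 2 * n%:R) *
          \prod_(i <- s | c i == n) (1 - p i) <= 1].
Proof.
move=> + p01; elim: s => [_|r s IHs /= /andP[rs /IHs[c [n [c_le blk Q_gt Q_le]]]]].
  by exists (fun=> 0%N), 0%N; split=> //; rewrite !big_nil; lra.
pose c' i := if i == r then n else c i.
have c's a : \prod_(i <- s | c' i == a) (1 - p i) = \prod_(i <- s | c i == a) (1 - p i).
  rewrite big_seq_cond [RHS]big_seq_cond; apply: eq_bigl => i.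
  by rewrite /c'; have [->|//] := eqVneq i r; rewrite (negbTE rs).
have c'r : c' r = n by rewrite /c' eqxx.
have c'E a : \prod_(i <- r :: s | c' i == a) (1 - p i) =
    (if a == n then 1 - p r else 1) * \prod_(i <- s | c i == a) (1 - p i).
  by rewrite big_cons c'r c's eq_sym; case: eqP => _ //; rewrite mul1r.
have c'_le i : i \in r :: s -> (c' i <= n)%N.
  by rewrite inE /c'; have [//|_] := eqVneq i r => /c_le.
have blk' a : (a < n)%N ->
    1 / 4 <= \prod_(i <- r :: s | c' i == a) (1 - p i) <= 1 / 2.
  by move=> an; rewrite c'E (ltn_eqF an) [X in _ <= X <= _]mul1r; apply: blk.
have /andP[p0 p1] := p01 r.
set Q := \prod_(i <- s | c i == n) (1 - p i) in Q_gt Q_le.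
set S := \sum_(i <- s) p i in Q_le.
(* The new element joins the open block [n], which is closed once its product is at most 1/2. The
   product was above 1/2 and [p r <= 1 / 2], so it stays above 1/4. *)
have [Q'_gt|Q'_le] := ltP (1 / 2) ((1 - p r) * Q).
  exists c', n; split => //; first by rewrite c'E eqxx.
  rewrite c'E eqxx big_cons -/S -/Q.
  have Q1 : Q <= 1.
    by apply: prodr_ile1 => i _; have /andP[pi0 pi1] := p01 i; apply/andP; split; lra.
  set S' := S - 3 / 2 * n%:R.
  have {}Q_le : (1 + S') * Q <= 1 by rewrite /S' addrA.
  have -> : 1 + (p r + S) - 3 / 2 * n%:R = 1 + (S' + p r) by rewrite /S'; ring.
  (* For a positive sum, the potential drops by exactly [p r * ((S' + p r) * Q)]. *)
  have [neg|pos] := leP (S' + p r) 0; first by nra.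
  have : 0 <= p r * ((S' + p r) * Q) by rewrite !mulr_ge0// ?ltW//; lra.
  by nra.
have prod0 : \prod_(i <- r :: s | c' i == n.+1) (1 - p i) = 1.
  rewrite big_seq_cond big_pred0// => i; apply/negbTE/negP => /andP[/c'_le le_i /eqP eq_i].
  by rewrite eq_i ltnn in le_i.
exists c', n.+1; split.
- by move=> i /c'_le /leqW.
- move=> a; rewrite ltnS leq_eqVlt => /orP[/eqP ->|/blk' //].
  by rewrite c'E eqxx -/Q Q'_le andbT; nra.
- by rewrite prod0; lra.
(* [Q > 1 / 2] forces the excess [S - 3 / 2 * n%:R] below 1, and [p r] adds at most 1/2; this is the
   source of 3/2. *)
- rewrite prod0 mulr1 big_cons -/S -natr1; nra.
Qed.

(** Elements outside [C] share the label [n] with the unfinished block. The product of that block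
    exceeds 1/2, which leaves an excess of at most 1 in the sum. *)
Lemma block_partition (R : realFieldType) (I : finType) (p : I -> R) (C : pred I) :
  (forall i, 0 <= p i <= 1 / 2) ->
  exists (c : I -> nat) (n : nat),
    [/\ forall i, (c i < n)%N -> C i,
        forall a, (a < n)%N -> 1 / 4 <= \prod_(i | c i == a) (1 - p i) <= 1 / 2 &
        \sum_(i | C i) p i <= 3 / 2 * n%:R + 1].
Proof.
move=> p01.
have [c [n [_ blk Q_gt Q_le]]] :=
  greedy_blocks (filter_uniq C (index_enum_uniq I)) p01.
exists (fun i => if C i then c i else n), n; split.
- by move=> i; case: ifP => //; rewrite ltnn.
- move=> a an; have := blk a an; rewrite big_filter_cond.
  rewrite [in X in _ -> X](eq_bigl (fun i => C i && (c i == a)))// => i /=.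
  by case: (C i) => //=; rewrite gtn_eqF.
- move: Q_le; rewrite big_filter => Q_le; nra.
Qed.

End Blocks.

(** * The monotone function and its far variants *)

Section HardInstances.
Variables (R : realType) (d n : nat) (mu : 'I_d -> R) (c : 'I_d -> nat) (b : bool).

(* The blocks are the fibres of [c] over [0, .., n - 1]; [b] is the rare value
   of all their coordinates. The block function is the disjunction of the block
   for [b = true] and its conjunction for [b = false]. *)
Definition block_fun (x : cube d) : cube n :=
  [ffun a : 'I_n => ~~ [forall r, (c r == a) ==> (x r == ~~ b)] == b].

Lemma block_fun_le (x y : cube d) : cube_le x y -> cube_le (block_fun x) (block_fun y).
Proof.
move=> /forallP xy; apply/forallP => a; rewrite !ffunE; apply/implyP.
case: b => /=; rewrite ?eqb_id ?eqbF_neg ?negbK.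
  apply: contra => /forallP y0; apply/forallP => r; apply/implyP => cr.
  by have /implyP/(_ cr) := y0 r; have := xy r; case: (x r); case: (y r).
move=> /forallP x1; apply/forallP => r; apply/implyP => cr.
by have /implyP/(_ cr) := x1 r; have := xy r; case: (x r); case: (y r).
Qed.

Lemma binval_le (z z' : cube n) : cube_le z z' -> (binval z <= binval z')%N.
Proof.
move=> /forallP zz'; apply: leq_sum => a _; apply: leq_mul => //.
by have := zz' a; case: (z a); case: (z' a).
Qed.

Lemma nth_sorted_lt (s : seq nat) (i j : nat) : path ltn 0 s ->
  (j < size s)%N -> (i < j)%N -> (nth 0%N s i < nth 0%N s j)%N.
Proof.
move=> /path_sorted s_sorted js ij.
by apply: (sorted_ltn_nth ltn_trans) => //; rewrite inE// (ltn_trans ij).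
Qed.

Lemma monotone_accept (s : seq nat) : path ltn 0 s ->
  (forall z : cube n, (binval z < size s)%N) ->
  Defs.monotone (fun x => nth 0%N s (binval (block_fun x))).
Proof.
move=> s_path s_size x y /block_fun_le/binval_le.
by rewrite leq_eqVlt => /orP[/eqP -> //|/nth_sorted_lt lt_nth]; rewrite ltnW// lt_nth.
Qed.

(** Take [x] with no rare value on block [a] and [y] with one, equal elsewhere. They are comparable,
    and their block functions differ only in bit [a], so the flip reverses their values strictly. A
    monotone [g] must then disagree at one of them. *)
Lemma flip_far (eps : R) (s : seq nat) (a : 'I_n) :
  (forall r, 0 <= mu r <= 1) ->
  path ltn 0 s -> (forall z : cube n, (binval z < size s)%N) ->
  (let w := \prod_(r < d | c r == a) (if ~~ b then 1 - mu r else mu r) in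
   eps < w < 1 - eps) ->
  far mu eps (fun x => nth 0%N s (binval (flip a (block_fun x)))).
Proof.
move=> mu01 s_path s_size w_eps g g_mono.
pose f x := nth 0%N s (binval (flip a (block_fun x))).
apply: (lt_le_trans _ (@bad_weight_ge _ _ _ mu01 (fun r => c r == a) (~~ b)
  (fun x => f x != g x) _)).
  by rewrite lt_min; move: w_eps => /= /andP[-> w_lt] /=; rewrite ltrBrDr -ltrBrDl.
move=> x y x_in y_out xy_eq.
have Zx : block_fun x a = ~~ b by rewrite ffunE x_in; case: (b).
have Zy : block_fun y a = b by rewrite ffunE y_out; case: (b).
have Zxy (t : 'I_n) : t != a -> block_fun x t = block_fun y t.
  move=> ta; rewrite !ffunE; congr (~~ _ == _); apply: eq_forallb => r.
  have [cr|//] := eqVneq (c r) t; rewrite xy_eq// cr.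
  by apply: contra ta => /eqP/val_inj ->.
have top : topdiff a (flip a (block_fun x)) (flip a (block_fun y)).
  rewrite topdiff_flip /topdiff Zx Zy; case: (b) => /=; apply/forallP => t;
    by apply/implyP => ta; rewrite Zxy// -val_eqE gtn_eqF.
have pivot r : c r == a -> x r = ~~ b.
  by move=> cr; have /forallP/(_ r) := x_in; rewrite cr => /eqP.
rewrite -negb_and; apply/negP => /andP[/eqP fgx /eqP fgy].
have flip_lt z z' : topdiff a (flip a z) (flip a z') -> z' a = false ->
    (nth 0%N s (binval (flip a z)) < nth 0%N s (binval (flip a z')))%N.
  move=> top_zz' z'a; apply: nth_sorted_lt => //.
  by rewrite (topdiff_binval_lt top_zz')// ffunE z'a eqxx.
case: (boolP b) => [b1|/negbTE b0].
  have xy : cube_le x y.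
    apply/forallP => r; have [cr|cr] := boolP (c r == a).
      by rewrite pivot// b1.
    by rewrite xy_eq// implybb.
  have := g_mono _ _ xy; rewrite -fgx -fgy leqNgt => /negP; apply.
  by apply: flip_lt; rewrite ?Zx ?b1// topdiffC.
have yx : cube_le y x.
  apply/forallP => r; have [cr|cr] := boolP (c r == a).
    by rewrite pivot// b0 implybT.
  by rewrite xy_eq// implybb.
have := g_mono _ _ yx; rewrite -fgx -fgy leqNgt => /negP; apply.
by apply: flip_lt; rewrite ?Zy ?b0.
Qed.

End HardInstances.

(** * Assembly of the lower bound *)

Theorem theorem5p11 :
  exists N : nat, (0 < N)%N /\
  forall (R : realType) (d : nat) (mu : 'I_d -> R) (eps : R),
    (forall r, 0 <= mu r <= 1) ->
    eps <= 1 / 10 ->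
    N%:R <= \sum_(r < d) Num.min (mu r) (1 - mu r) ->
    forall (d0 : measure_display) (Omega : measurableType d0)
           (P : probability Omega R) (T : Omega -> qtree d) (q : nat),
      mono_tester mu eps P T q ->
      \sum_(r < d) Num.min (mu r) (1 - mu r) <= N%:R * q%:R.
Proof.
(* The sum is at most [9 * q + 2], hence at most [11 * q] for positive [q]; for [q = 0] the bound 2
   contradicts the assumed lower bound 11. *)
exists 11%N; split=> // R d mu eps mu01 eps10 N_le d0 Omega P T q tester.
pose p r := Num.min (mu r) (1 - mu r).
change (\sum_(r < d) p r <= 11 * q%:R).
have p01 r : 0 <= p r <= 1 / 2.
  have /andP[mu0 mu1] := mu01 r; rewrite /p le_min ge_min mu0 subr_ge0 mu1/=.
  by have [//|?] := leP (mu r) (1 / 2); lra.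
have [G [G01 G_local G_large [G_le1 G_acc] G_rej]] := tester_profile tester.
(* Coordinates are grouped by their rare value [b], so that within a block the rare event is an
   up-set or a down-set. *)
have class_le (b : bool) :
    \sum_(r | (1 / 2 <= mu r) == b) p r <= 9 / 2 * q%:R + 1.
  have [c [n [c_class blk]]] := block_partition (fun r => (1 / 2 <= mu r) == b) p01.
  suff : (n <= 3 * q)%N by rewrite -(ler_nat R) natrM; lra.
  apply: (@query_bound R d n q (block_fun n c b) G) => //.
    by move=> s s_path s_size; apply: G_acc; apply: monotone_accept.
  move=> s a s_path s_size; apply: G_rej; apply: flip_far => //=.
  have -> : \prod_(r < d | c r == a) (if ~~ b then 1 - mu r else mu r) =
      \prod_(r < d | c r == a) (1 - p r).
    apply: eq_bigr => r /eqP cra; have := c_class r.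
    rewrite cra ltn_ord => /(_ isT)/eqP <-; rewrite /p.
    by case: leP => half /=; case: leP; lra.
  (* The block product lies between 1/4 and 1/2, so it is at distance more than 1/10 from both 0 and
     1. *)
  by have /andP[] := blk a (ltn_ord a); move=> *; apply/andP; split; lra.
have total : \sum_(r < d) p r <= 9 * q%:R + 2.
  rewrite (bigID (fun r => 1 / 2 <= mu r))/=.
  have := class_le true; rewrite (eq_bigl _ _ (fun r => eqb_id _)).
  have := class_le false; rewrite (eq_bigl _ _ (fun r => eqbF_neg _)).
  by lra.
apply: (le_trans total).
have [q0|q_gt0] := posnP q; last by have : 1 <= q%:R :> R; rewrite ?ler1n//; lra.
by have := le_trans N_le total; rewrite q0; lra.
Qed.
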